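(* Let $n\in\mathbb N$, let $S$ be a nondegenerate simplex in $\mathbb R^n$, let $x^{(0)}=(x^{(0)}_1,\dots,x^{(0)}_n)\in\mathbb R^n$ and $\varrho>0$. If $B(x^{(0)};\varrho)\not\subset S$, then $$\xi\bigl(B(x^{(0)};\varrho);S\bigr)=(n+1)\max_{1\le j\le n+1}\left[\varrho\Bigl(\sum_{i=1}^n l_{ij}^2\Bigr)^{1/2}-\sum_{i=1}^n l_{ij}x^{(0)}_i-l_{n+1,j}\right]+1.$$ In particular, if $B_n\not\subset S$, then $$\xi(B_n;S)=(n+1)\max_{1\le j\le n+1}\left[\Bigl(\sum_{i=1}^n l_{ij}^2\Bigr)^{1/2}-l_{n+1,j}\right]+1.$$
   Context: $B(x^{(0)};\varrho)=\{x\in\mathbb R^n:\|x-x^{(0)}\|\le\varrho\}$ with the Euclidean norm, and $B_n=B(0;1)$. For a nondegenerate simplex $S\subset\mathbb R^n$, $\tau S$ denotes the image of $S$ under the homothety with center at the center of gravity of $S$ and ratio $\tau$. For a convex body $C\subset\mathbb R^n$, the absorption index is $\xi(C;S)=\min\{\sigma\ge 1: C\subset\sigma S\}$. Let $x^{(j)}=(x^{(j)}_1,\dots,x^{(j)}_n)$, $1\le j\le n+1$, be the vertices of $S$, and let $\mathbf A$ be the $(n+1)\times(n+1)$ matrix whose $j$-th row is $(x^{(j)}_1,\dots,x^{(j)}_n,1)$; it is nondegenerate. The numbers $l_{ij}$ are the entries of $\mathbf A^{-1}=(l_{ij})$. *)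

(* Defs.v *)
From mathcomp Require Import all_boot all_order all_algebra.
From mathcomp Require Import boolp classical_sets reals.

Set Implicit Arguments.
Unset Strict Implicit.
Unset Printing Implicit Defensive.

Import Order.TTheory GRing.Theory Num.Theory.
Local Open Scope classical_set_scope.
Local Open Scope ring_scope.

(* The norm that MathComp-Analysis puts on ['rV[R]_n] is the sup norm. *)
Definition euclidean_norm (R : realType) (n : nat) (v : 'rV[R]_n) : R :=
  Num.sqrt (\sum_(i < n) v 0 i ^+ 2).

Definition euclidean_ball (R : realType) (n : nat) (c : 'rV[R]_n) (r : R) :
    set 'rV[R]_n :=
  [set y | euclidean_norm (y - c) <= r].

Definition affinely_independent (R : realType) (n m : nat)
    (x : 'I_m -> 'rV[R]_n) : Prop :=
  forall a : 'I_m -> R,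
    \sum_j a j = 0 -> \sum_j a j *: x j = 0 -> forall j, a j = 0.

(* The convex hull of the points [x j]; it is a nondegenerate simplex of
   R^n, with vertices [x j], when the n+1 points are affinely independent. *)
Definition simplex (R : realType) (n : nat) (x : 'I_n.+1 -> 'rV[R]_n) :
    set 'rV[R]_n :=
  [set y | exists a : 'I_n.+1 -> R,
     [/\ forall j, 0 <= a j, \sum_j a j = 1 & y = \sum_j a j *: x j]].

(* The center of gravity of a simplex is that of its vertices, taken with
   equal masses. *)
Definition centroid (R : realType) (n : nat) (x : 'I_n.+1 -> 'rV[R]_n) :
    'rV[R]_n :=
  n.+1%:R^-1 *: \sum_j x j.

Definition homothety (R : realType) (n : nat) (c : 'rV[R]_n) (t : R)
    (y : 'rV[R]_n) : 'rV[R]_n :=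
  c + t *: (y - c).

Definition dilated_simplex (R : realType) (n : nat) (t : R)
    (x : 'I_n.+1 -> 'rV[R]_n) : set 'rV[R]_n :=
  homothety (centroid x) t @` simplex x.

Definition absorbing_ratios (R : realType) (n : nat) (C : set 'rV[R]_n)
    (x : 'I_n.+1 -> 'rV[R]_n) : set R :=
  [set s | 1 <= s /\ C `<=` dilated_simplex s x].

Definition minimums (R : realType) (E : set R) : set R := E `&` lbound E.

(* The minimum of the absorbing ratios. The default value 0 is returned when
   there is no minimum; it is never an absorbing ratio, as these are >= 1. *)
Definition absorption_index (R : realType) (n : nat) (C : set 'rV[R]_n)
    (x : 'I_n.+1 -> 'rV[R]_n) : R :=
  xget 0 (minimums (absorbing_ratios C x)).

(* Row [j] is [(x j, 1)]: the coordinate index [i : 'I_n] sits in column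
   [lift ord_max i], of the same numerical value, and the column of ones is
   [ord_max]. *)
Definition vertex_matrix (R : realType) (n : nat) (x : 'I_n.+1 -> 'rV[R]_n) :
    'M[R]_n.+1 :=
  \matrix_(j, i) if unlift ord_max i is Some k then x j 0 k else 1.

Definition lcoef (R : realType) (n : nat) (x : 'I_n.+1 -> 'rV[R]_n)
    (i j : 'I_n.+1) : R :=
  invmx (vertex_matrix x) i j.

(* Seeding with the value at [ord0] makes this the maximum of [f], whatever
   the signs of its values. *)
Definition max_over (R : realType) (n : nat) (f : 'I_n.+1 -> R) : R :=
  \big[Num.max/f ord0]_(j < n.+1) f j.

(* Main.v *)
Require Import Defs.
From mathcomp Require Import all_boot all_order all_algebra.
From mathcomp Require Import boolp classical_sets reals.
From mathcomp Require Import ring lra.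

Set Implicit Arguments.
Unset Strict Implicit.
Unset Printing Implicit Defensive.

Import Order.TTheory GRing.Theory Num.Theory.
Local Open Scope classical_set_scope.
Local Open Scope ring_scope.

(** The barycentric coordinates of [y] are the affine forms
    [lam_j y = \sum_i l_ij y_i + l_(n+1)j]. The homothety of ratio [t] sends
    [lam_j] to [(1 - t) / (n + 1) + t lam_j], so [y] lies in [t S] iff
    [(n + 1) (- lam_j y) + 1 <= t] for all [j]. By Cauchy-Schwarz, the maximum
    of [- lam_j] over the ball is the [j]-th bracket of the formula. If the ball
    is not inside [S = 1 S], the bound obtained exceeds [1], so that the
    constraint [1 <= t] plays no role. *)

Lemma le_max_over (R : realType) (n : nat) (f : 'I_n.+1 -> R) (a : R) :
  max_over f <= a <-> forall j, f j <= a.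
Proof.
split=> [fa j|fa]; first exact: le_trans (le_bigmax _ _ _) fa.
exact: bigmax_le.
Qed.

Lemma sqr_euclidean_norm (R : realType) (n : nat) (v : 'rV[R]_n) :
  euclidean_norm v ^+ 2 = \sum_i v 0 i ^+ 2.
Proof. by rewrite sqr_sqrtr // sumr_ge0 // => i _; rewrite sqr_ge0. Qed.

Lemma euclidean_norm_eq0 (R : realType) (n : nat) (v : 'rV[R]_n) :
  euclidean_norm v = 0 -> v = 0.
Proof.
move=> v0; have /eqP := sqr_euclidean_norm v.
rewrite v0 expr0n eq_sym psumr_eq0 => [|i _]; last exact: sqr_ge0.
move=> /allP vi0; apply/rowP => i; rewrite mxE.
by apply/eqP; rewrite -sqrf_eq0; exact: (vi0 i (mem_index_enum i)).
Qed.

Lemma euclidean_normZ (R : realType) (n : nat) (a : R) (v : 'rV[R]_n) :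
  euclidean_norm (a *: v) = `|a| * euclidean_norm v.
Proof.
rewrite /euclidean_norm -sqrtr_sqr -sqrtrM ?sqr_ge0// mulr_sumr.
by congr Num.sqrt; apply: eq_bigr => i _; rewrite mxE exprMn.
Qed.

Lemma cauchy_schwarzN (R : realType) (n : nat) (u v : 'rV[R]_n) :
  - (\sum_i u 0 i * v 0 i) <= euclidean_norm u * euclidean_norm v.
Proof.
set p := euclidean_norm u; set q := euclidean_norm v.
have p0 : 0 <= p by exact: sqrtr_ge0.
have q0 : 0 <= q by exact: sqrtr_ge0.
have [/euclidean_norm_eq0 ->|pN0] := eqVneq p 0.
  by rewrite big1 ?oppr0 ?mulr_ge0// => i _; rewrite mxE mul0r.
have [/euclidean_norm_eq0 ->|qN0] := eqVneq q 0.
  by rewrite big1 ?oppr0 ?mulr_ge0// => i _; rewrite mxE mulr0.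
have pq0 : 0 < p * q *+ 2 by rewrite pmulrn_lgt0// mulr_gt0// lt0r ?pN0 ?qN0.
(* The weights [q] and [p] balance the squares: the sum equals [2 p^2 q^2 + 2 p q <u, v>], and
   dividing by [2 p q > 0] gives the claim. *)
have : 0 <= \sum_i (q * u 0 i + p * v 0 i) ^+ 2.
  by rewrite sumr_ge0// => i _; rewrite sqr_ge0.
under eq_bigr => i _.
  rewrite (_ : _ ^+ 2 = q ^+ 2 * u 0 i ^+ 2 + p * q *+ 2 * (u 0 i * v 0 i)
    + p ^+ 2 * v 0 i ^+ 2); last by ring.
  over.
rewrite !big_split/= -!mulr_sumr -!sqr_euclidean_norm -/p -/q => h.
rewrite -(ler_pM2l pq0); nra.
Qed.

Section Barycentric.
Context (R : realType) (n : nat) (x : 'I_n.+1 -> 'rV[R]_n).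

Definition bary (y : 'rV[R]_n) (j : 'I_n.+1) : R :=
  \sum_(i < n) lcoef x (lift ord_max i) j * y 0 i + lcoef x ord_max j.

Definition lcoef_row (j : 'I_n.+1) : 'rV[R]_n :=
  \row_i lcoef x (lift ord_max i) j.

(** Homogeneous coordinates [(y, 1)], in the column order of [vertex_matrix]. *)
Definition lift_row (y : 'rV[R]_n) : 'rV[R]_n.+1 :=
  \row_i if unlift ord_max i is Some k then y 0 k else 1.

(** The column of ones records the total weight and the other columns the weighted point, so
    barycentric coordinates are the solutions of a single linear system. *)
Lemma mulmx_vertex_matrix (a : 'rV[R]_n.+1) (y : 'rV[R]_n) :
  a *m vertex_matrix x = lift_row y <->
  \sum_j a 0 j = 1 /\ y = \sum_j a 0 j *: x j.
Proof.
split=> [/rowP aA|[a1 ay]].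
  split.
    move: (aA ord_max); rewrite !mxE unlift_none => <-.
    by apply: eq_bigr => j _; rewrite mxE unlift_none mulr1.
  apply/rowP => i; move: (aA (lift ord_max i)); rewrite !mxE liftK => <-.
  by rewrite summxE; apply: eq_bigr => j _; rewrite !mxE liftK.
apply/rowP => i; rewrite !mxE; case: unliftP => [k ->|->].
  by rewrite ay summxE; apply: eq_bigr => j _; rewrite !mxE liftK.
by rewrite -a1; apply: eq_bigr => j _; rewrite mxE unlift_none mulr1.
Qed.

Lemma baryE (y : 'rV[R]_n) (j : 'I_n.+1) :
  bary y j = (lift_row y *m invmx (vertex_matrix x)) 0 j.
Proof.
rewrite mxE (bigD1_ord ord_max)//= mxE unlift_none mul1r addrC; congr (_ + _).
by apply: eq_bigr => i _; rewrite !mxE liftK mulrC.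
Qed.

Lemma bary_homothety (c y : 'rV[R]_n) (t : R) (j : 'I_n.+1) :
  bary (homothety c t y) j = (1 - t) * bary c j + t * bary y j.
Proof.
rewrite /bary.
under eq_bigr => i _.
  rewrite !mxE (_ : _ * _ = (1 - t) * (lcoef x (lift ord_max i) j * c 0 i)
    + t * (lcoef x (lift ord_max i) j * y 0 i)); last by ring.
  over.
by rewrite big_split/= -!mulr_sumr; ring.
Qed.

(** The linear part of [bary _ j] is the scalar product with [lcoef_row j]. Cauchy-Schwarz bounds
    its decrease from [c], and moving from [c] against [lcoef_row j] up to the sphere attains the
    bound. Quantifying over upper bounds [b] fits the later use of [le_max_over]. *)
Lemma ball_bary_le (c : 'rV[R]_n) (r b : R) (j : 'I_n.+1) : 0 < r ->
  (forall y, euclidean_ball c r y -> - bary y j <= b) <->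
  r * euclidean_norm (lcoef_row j) - \sum_i lcoef x (lift ord_max i) j * c 0 i
    - lcoef x ord_max j <= b.
Proof.
move=> r0; set N := euclidean_norm _.
have baryB y : bary y j = bary c j + \sum_i lcoef_row j 0 i * (y - c) 0 i.
  rewrite /bary addrAC -big_split/=; congr (_ + _).
  by apply: eq_bigr => i _; rewrite !mxE; ring.
split=> [h|h y /= cy].
  (* When [N = 0], the junk value [N^-1 = 0] makes [y = c]. *)
  pose y := c - (r / N) *: lcoef_row j.
  have N0 : 0 <= N by exact: sqrtr_ge0.
  have yc : y - c = (- (r / N)) *: lcoef_row j by rewrite scaleNr addrC addKr.
  have /h : euclidean_ball c r y.
    rewrite /euclidean_ball /= yc euclidean_normZ normrN ger0_norm; last first.
      by rewrite divr_ge0// ltW.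
    by rewrite -/N; have [->|N_0] := eqVneq N 0; rewrite ?mulr0 ?divfK// ltW.
  rewrite baryB yc.
  under eq_bigr do rewrite (mxE scalemx_key) mulrCA -expr2.
  rewrite -mulr_sumr -sqr_euclidean_norm -/N /bary.
  rewrite (_ : - (r / N) * N ^+ 2 = - (r * N)); first by lra.
  have [->|N_0] := eqVneq N 0; first by ring.
  by field.
rewrite baryB; have := cauchy_schwarzN (lcoef_row j) (y - c); rewrite -/N.
have : N * euclidean_norm (y - c) <= N * r by rewrite ler_wpM2l ?sqrtr_ge0.
rewrite /bary; lra.
Qed.

Hypothesis hx : affinely_independent x.

(** A row vector killed by the matrix is an affine dependence between the vertices: the column of
    ones says that its weights sum to 0, the others that the weighted sum of the vertices is 0. *)
Lemma vertex_matrix_unit : vertex_matrix x \in unitmx.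
Proof.
rewrite -row_free_unit; apply: inj_row_free => v /rowP vA.
apply/rowP => j; rewrite [RHS]mxE; apply: (@hx (v 0)).
  move: (vA ord_max); rewrite !mxE => vA0; rewrite -[RHS]vA0.
  by apply: eq_bigr => i _; rewrite mxE unlift_none mulr1.
apply/rowP => i; move: (vA (lift ord_max i)); rewrite !mxE => vAi.
rewrite -[RHS]vAi.
by rewrite summxE; apply: eq_bigr => k _; rewrite !mxE liftK.
Qed.

Lemma bary_sum (y : 'rV[R]_n) :
  \sum_j bary y j = 1 /\ y = \sum_j bary y j *: x j.
Proof.
under eq_bigr do rewrite baryE.
under [in X in _ /\ X]eq_bigr do rewrite baryE.
by apply/mulmx_vertex_matrix; rewrite mulmxKV// vertex_matrix_unit.
Qed.

Lemma bary_unique (a : 'I_n.+1 -> R) (y : 'rV[R]_n) (j : 'I_n.+1) :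
  \sum_k a k = 1 -> y = \sum_k a k *: x k -> bary y j = a j.
Proof.
move=> a1 ay; have /(mulmx_vertex_matrix (\row_k a k) y) aA :
    \sum_k (\row_k a k) 0 k = 1 /\ y = \sum_k (\row_k a k) 0 k *: x k.
  by split; [rewrite -a1|rewrite ay]; apply: eq_bigr => k _; rewrite mxE.
by rewrite baryE -aA mulmxK ?mxE// vertex_matrix_unit.
Qed.

Lemma bary_centroid (j : 'I_n.+1) : bary (centroid x) j = n.+1%:R^-1.
Proof.
apply: (bary_unique (a := fun=> n.+1%:R^-1)); last by rewrite -scaler_sumr.
by rewrite sumr_const card_ord -[LHS]mulr_natr mulVf// pnatr_eq0.
Qed.

Lemma simplexE (y : 'rV[R]_n) : simplex x y <-> forall j, 0 <= bary y j.
Proof.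
split=> [[a [a0 a1 ay]] j|y0]; first by rewrite (bary_unique _ a1 ay).
by have [y1 yE] := bary_sum y; exists (bary y).
Qed.

(** The image of [z] has [j]-th coordinate [(1 - t) / (n + 1) + t * bary z j], so [0 <= bary z j]
    turns into the stated bound. Conversely, as [t] is nonzero, the homothety of ratio [t^-1]
    supplies the preimage. *)
Lemma dilated_simplexE (t : R) (y : 'rV[R]_n) : 0 < t ->
  dilated_simplex t x y <-> forall j, - bary y j <= (t - 1) / n.+1%:R.
Proof.
move=> t0; split=> [[z /simplexE z0 <-] j|yt].
  rewrite bary_homothety bary_centroid.
  have : 0 <= t * bary z j by rewrite mulr_ge0// ltW.
  by move: n.+1%:R^-1 => m; lra.
have tK : homothety (centroid x) t (homothety (centroid x) t^-1 y) = y.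
  rewrite /homothety (addrC _ (t^-1 *: _)) addrK scalerA divff ?gt_eqF//.
  by rewrite scale1r addrC subrK.
exists (homothety (centroid x) t^-1 y) => //.
apply/simplexE => j; rewrite -(pmulr_rge0 _ t0).
have := bary_homothety (centroid x) (homothety (centroid x) t^-1 y) t j.
rewrite tK bary_centroid; have := yt j.
by move: n.+1%:R^-1 => m; lra.
Qed.

Lemma dilated_simplex1 : dilated_simplex 1 x = simplex x.
Proof.
by apply/seteqP; split=> y;
  rewrite dilated_simplexE// simplexE subrr mul0r => h j;
  move: (h j); rewrite oppr_le0.
Qed.

(** The first conjunct certifies that the minimum exists, so the formula does not describe the
    default value of [xget]. *)
Lemma absorption_index_ball (c : 'rV[R]_n) (r : R) : 0 < r ->
  ~ euclidean_ball c r `<=` simplex x ->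
  minimums (absorbing_ratios (euclidean_ball c r) x)
    (absorption_index (euclidean_ball c r) x) /\
  absorption_index (euclidean_ball c r) x =
    n.+1%:R * max_over (fun j =>
      r * Num.sqrt (\sum_(i < n) lcoef x (lift ord_max i) j ^+ 2)
      - \sum_(i < n) lcoef x (lift ord_max i) j * c 0 i
      - lcoef x ord_max j) + 1.
Proof.
move=> r0 ballNS; set f := fun j => _ - _ - _; set m := _ + 1.
have normE j : Num.sqrt (\sum_(i < n) lcoef x (lift ord_max i) j ^+ 2) =
    euclidean_norm (lcoef_row j).
  by congr Num.sqrt; apply: eq_bigr => i _; rewrite mxE.
(* Both sides say that [- bary y j <= (t - 1) / (n + 1)] for all [y] in the ball and all [j]; the
   maximum of the brackets comes from fixing [j] first. *)
have ballE t : 0 < t ->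
    euclidean_ball c r `<=` dilated_simplex t x <-> m <= t.
  move=> t0; rewrite /m -lerBrDr mulrC -ler_pdivlMr ?ltr0n// le_max_over.
  split=> [sub j|le_f y cy].
    rewrite /f normE; apply/ball_bary_le => // y /sub.
    by rewrite dilated_simplexE.
  rewrite dilated_simplexE// => j; move: y cy.
  by apply/ball_bary_le; rewrite // -normE; exact: le_f.
(* If [m <= 1], then [ballE] at ratio 1 would put the ball inside the simplex itself. *)
have m1 : 1 < m.
  rewrite ltNge; apply/negP => /(ballE 1 ltr01).
  by rewrite dilated_simplex1.
have m_min : minimums (absorbing_ratios (euclidean_ball c r) x) m.
  split; first by split; [exact: ltW|apply/ballE => //; exact: lt_trans m1].
  by move=> t [t1 sub]; apply/ballE => //; exact: lt_le_trans t1.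
(* Two minimums of the same set bound each other, so [xget] can only return [m]. *)
have -> : absorption_index (euclidean_ball c r) x = m.
  apply: xget_unique => // s [sA s_min]; apply/le_anti/andP.
  by split; [apply: s_min|apply: m_min.2]; case: m_min.
by split.
Qed.

End Barycentric.

Theorem theorem3 (R : realType) (n : nat) (hn : (0 < n)%N)
    (x : 'I_n.+1 -> 'rV[R]_n) (hx : affinely_independent x) :
  (forall (x0 : 'rV[R]_n) (rho : R), 0 < rho ->
     ~ euclidean_ball x0 rho `<=` simplex x ->
     minimums (absorbing_ratios (euclidean_ball x0 rho) x)
       (absorption_index (euclidean_ball x0 rho) x) /\
     absorption_index (euclidean_ball x0 rho) x =
       n.+1%:R * max_over (fun j : 'I_n.+1 =>
         rho * Num.sqrt (\sum_(i < n) lcoef x (lift ord_max i) j ^+ 2)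
         - \sum_(i < n) lcoef x (lift ord_max i) j * x0 0 i
         - lcoef x ord_max j) + 1) /\
  (~ euclidean_ball (0 : 'rV[R]_n) 1 `<=` simplex x ->
   minimums (absorbing_ratios (euclidean_ball (0 : 'rV[R]_n) 1) x)
     (absorption_index (euclidean_ball (0 : 'rV[R]_n) 1) x) /\
   absorption_index (euclidean_ball (0 : 'rV[R]_n) 1) x =
     n.+1%:R * max_over (fun j : 'I_n.+1 =>
       Num.sqrt (\sum_(i < n) lcoef x (lift ord_max i) j ^+ 2)
       - lcoef x ord_max j) + 1).
Proof.
split=> [x0 rho|ballNS]; first exact: absorption_index_ball.
have [min0 idx0] := absorption_index_ball hx ltr01 ballNS.
split=> //; rewrite idx0; congr (_ * max_over _ + 1); apply/funext => j.
(* At center 0 the linear term of the bracket vanishes. *)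
rewrite mul1r [X in _ - X - _]big1 ?subr0// => i _.
by rewrite mxE mulr0.
Qed.
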